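(* Let $\mathcal{G}=(\mathcal{V},\mathcal{E},\mathbf{W})$ be a connected signed weighted undirected graph with Laplacian matrix $L$. Then $L$ is positive semi-definite with only one zero eigenvalue if and only if $g_{\mathrm{eff}}(L,\mathcal{V}_a,\mathcal{V}_b)>0$ for any two non-empty disjoint sets $\mathcal{V}_a,\mathcal{V}_b\subset\mathcal{V}$.
   Context: Graph: $\mathcal{G}=(\mathcal{V},\mathcal{E},\mathbf{W})$ is a simple undirected connected graph with finite node set $\mathcal{V}$, $n=|\mathcal{V}|$, edge set $\mathcal{E}$, $l=|\mathcal{E}|$; each edge $(i,j)$ carries a nonzero real weight $w_{ij}$, positive or negative, and $\mathbf{W}\in\mathbb{R}^{l\times l}$ is the diagonal matrix of edge weights. With the edges arbitrarily oriented, $\mathbf{E}\in\mathbb{R}^{n\times l}$ is the incidence matrix (column of an edge from $i$ to $j$: entry $1$ in row $i$, $-1$ in row $j$, $0$ elsewhere). The Laplacian is $L=\mathbf{E}\mathbf{W}\mathbf{E}^T$ (real symmetric with zero row sums). ''Positive semi-definite with only one zero eigenvalue'' means $L\succeq 0$ and $0$ is a simple eigenvalue. Effective conductance: for non-empty disjoint $\mathcal{V}_a,\mathcal{V}_b\subset\mathcal{V}$ put $\mathcal{V}_c=\mathcal{V}\setminus(\mathcal{V}_a\cup\mathcal{V}_b)$, $a=|\mathcal{V}_a|$, $b=|\mathcal{V}_b|$, and let $L_{xy}$ be the submatrix of $L$ with rows indexed by $\mathcal{V}_x$ and columns by $\mathcal{V}_y$. If $L_{cc}$ is nonsingular, let $L/L_{cc}$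 be the Schur complement $$L/L_{cc}=\begin{bmatrix}L_{aa}&L_{ab}\\L_{ab}^T&L_{bb}\end{bmatrix}-\begin{bmatrix}L_{ac}\\L_{bc}\end{bmatrix}L_{cc}^{-1}\begin{bmatrix}L_{ac}^T&L_{bc}^T\end{bmatrix},$$ with $L/L_{cc}=L$ if $\mathcal{V}_c=\emptyset$. Then $g_{\mathrm{eff}}(L,\mathcal{V}_a,\mathcal{V}_b)=\mathbf{e}_{\mathcal{V}_a}^T(L/L_{cc})\mathbf{e}_{\mathcal{V}_a}$, where $\mathbf{e}_{\mathcal{V}_a}\in\mathbb{R}^{a+b}$ has entries $1$ on $\mathcal{V}_a$ and $0$ on $\mathcal{V}_b$. Whenever $g_{\mathrm{eff}}$ is mentioned it is implicitly meant that the corresponding $L_{cc}$ is nonsingular; in particular ''$g_{\mathrm{eff}}(\cdot)>0$'' means that the corresponding $L_{cc}$ is nonsingular and the value is positive. *)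

(* Defs.v *)
From HB Require Import structures.
From mathcomp Require Import all_boot all_order all_algebra.
From mathcomp Require Import reals.

Set Implicit Arguments.
Unset Strict Implicit.
Unset Printing Implicit Defensive.

Import Order.TTheory GRing.Theory Num.Theory.
Local Open Scope ring_scope.

(* Only the values of [weight] on [edges] matter. *)
Record signed_graph (R : realType) (V : finType) := SignedGraph {
  edges : {set {set V}};
  weight : {set V} -> R;
  card_edge : forall e, e \in edges -> #|e| = 2%N;
  weight_neq0 : forall e, e \in edges -> weight e != 0
}.

Definition adj (R : realType) (V : finType) (G : signed_graph R V) : rel V :=
  [rel u v | [set u; v] \in edges G].

(* The graph without nodes does not count as connected. *)
Definition connected_graph (R : realType) (V : finType)
    (G : signed_graph R V) : Prop :=
  (0 < #|V|)%N /\ forall u v : V, connect (adj G) u v.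

(* [o e = (i, j)] orients the edge [e] from [i] to [j]. *)
Definition is_orientation (R : realType) (V : finType)
    (G : signed_graph R V) (o : {set V} -> V * V) : Prop :=
  forall e, e \in edges G -> e = [set (o e).1; (o e).2].

(* Nodes and edges are numbered by their rank in [enum V] and
   [enum (edges G)]. *)
Definition incidence_mx (R : realType) (V : finType)
    (G : signed_graph R V) (o : {set V} -> V * V) : 'M[R]_(#|V|, #|edges G|) :=
  \matrix_(i, k)
    let v : V := enum_val i in
    let e : {set V} := enum_val k in
    if v == (o e).1 then 1 else if v == (o e).2 then -1 else 0.

Definition weight_mx (R : realType) (V : finType) (G : signed_graph R V) :
    'M[R]_#|edges G| :=
  diag_mx (\row_k weight G (enum_val k)).

Definition laplacian (R : realType) (V : finType)
    (G : signed_graph R V) (o : {set V} -> V * V) : 'M[R]_#|V| :=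
  incidence_mx G o *m weight_mx G *m (incidence_mx G o)^T.

Definition psd (R : realType) (n : nat) (A : 'M[R]_n) : Prop :=
  A^T = A /\ forall x : 'cV[R]_n, 0 <= (x^T *m A *m x) 0 0.

Definition simple_eigenvalue (R : realType) (n : nat) (A : 'M[R]_n) (a : R) :
    Prop :=
  mup a (char_poly A) = 1%N.

Definition node_submx (R : realType) (V : finType) (L : 'M[R]_#|V|)
    (X Y : {set V}) : 'M[R]_(#|X|, #|Y|) :=
  mxsub (fun i : 'I_#|X| => enum_rank (enum_val i))
        (fun j : 'I_#|Y| => enum_rank (enum_val j)) L.

(* If [C] is empty, [node_submx L C C] is the 0 x 0 matrix, which is a unit,
   and the subtracted product is 0: the result is then [L], with rows and
   columns reordered so that those of [A] come first. *)
Definition schur_compl (R : realType) (V : finType) (L : 'M[R]_#|V|)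
    (A B : {set V}) : 'M[R]_(#|A| + #|B|) :=
  let C := ~: (A :|: B) in
  block_mx (node_submx L A A) (node_submx L A B)
           (node_submx L A B)^T (node_submx L B B)
  - col_mx (node_submx L A C) (node_submx L B C)
    *m invmx (node_submx L C C)
    *m row_mx (node_submx L A C)^T (node_submx L B C)^T.

(* Meaningful only if [node_submx L C C] is nonsingular for the complement [C]
   of [A :|: B]: [invmx] is the identity function on singular matrices. *)
Definition geff (R : realType) (V : finType) (L : 'M[R]_#|V|)
    (A B : {set V}) : R :=
  let eA : 'cV[R]_(#|A| + #|B|) := col_mx (const_mx 1) (const_mx 0) in
  (eA^T *m schur_compl L A B *m eA) 0 0.

Definition geff_defined (R : realType) (V : finType) (L : 'M[R]_#|V|)
    (A B : {set V}) : Prop :=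
  node_submx L (~: (A :|: B)) (~: (A :|: B)) \in unitmx.

(* Main.v *)
Require Import Defs.
From HB Require Import structures.
From mathcomp Require Import all_boot all_order all_algebra.
From mathcomp Require Import reals ring lra.

Set Implicit Arguments.
Unset Strict Implicit.
Unset Printing Implicit Defensive.

Import Order.TTheory GRing.Theory Num.Theory.
Local Open Scope ring_scope.

(** The quadratic form [qform L] is the energy of a potential on the nodes, and
    [geff L A B] is the energy of a particular one: the potential [h] that is 1
    on [A], 0 on [B] and harmonic elsewhere ([qform_harmonic_potential]).  The
    argument concerns any symmetric matrix that annihilates the constant
    potentials.  For such a matrix, 0 is a simple eigenvalue if and only if the
    kernel consists of the constants ([simple_eigenvalue0P]).

    If [L] is positive semi-definite with only the constants in its kernel, then
    every non-constant potential has positive energy ([psd_qform0]).  This makes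
    [L_CC] nonsingular for the complement [C] of [A :|: B], and gives [h]
    positive energy ([psd_geff_pos]).

    Conversely, the effective conductances between a node [a] of [C] and the
    complement of [C] are the pivots of a Gaussian elimination.  Adding the nodes
    one at a time and completing the square with the corresponding harmonic
    potential shows that the form is positive definite on the potentials
    supported on any proper subset of the nodes ([geff_pos_def_supp]).  Since the
    energy is invariant under addition of constants, every potential can be made
    to vanish at a given node, which gives the claim for all potentials
    ([geff_pos_psd]). *)

(** * Zero as a simple eigenvalue *)

Lemma unitmx_ker0P (R : fieldType) (n : nat) (A : 'M[R]_n) :
  reflect (forall z : 'cV[R]_n, A *m z = 0 -> z = 0) (A \in unitmx).
Proof.
apply: (iffP idP) => [uA z Az0 | kerA].
  by rewrite -(mulKmx uA z) Az0 mulmx0.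
rewrite unitmxE unitfE -det_tr; apply/det0P => -[v v_neq0 vA0].
have /(congr1 trmx) : v^T = 0.
  by apply: kerA; rewrite -[A]trmxK -trmx_mul vA0 trmx0.
by rewrite trmxK trmx0 => v0; rewrite v0 eqxx in v_neq0.
Qed.

Lemma char_poly_conj (R : fieldType) (n : nat) (A B P : 'M[R]_n) :
  P \in unitmx -> A *m P = P *m B -> char_poly A = char_poly B.
Proof.
move=> uP AP; rewrite /char_poly.
have /(congr1 determinant) :
    char_poly_mx A *m map_mx polyC P = map_mx polyC P *m char_poly_mx B.
  by rewrite mulmxBl mulmxBr -!map_mxM AP scalar_mxC.
rewrite !det_mulmx mulrC det_map_mx; apply: mulfI.
by rewrite polyC_eq0 -unitfE -unitmxE.
Qed.

Lemma mup_eq0 (R : fieldType) (a : R) (p : {poly R}) :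
  p != 0 -> (mup a p == 0%N) = ~~ root p a.
Proof. by move=> p_neq0; rewrite -leqn0 mup_leq // expr1 dvdp_XsubCl. Qed.

Lemma unitmx_char_poly (R : fieldType) (n : nat) (A : 'M[R]_n) :
  ~~ root (char_poly A) 0 = (A \in unitmx).
Proof.
by rewrite /root horner_coef0 char_poly_det mulf_eq0 signr_eq0 unitmxE unitfE.
Qed.

(** Conjugation by the matrix [P] whose first column is the all-ones vector
    turns [A] into a block upper triangular matrix with diagonal blocks 0 and [M], so
    that [char_poly A = 'X * char_poly M], and 0 is a simple root if and only if
    [M] is a unit.  Symmetry is what links this to the kernel of [A]: a [z] with
    [M *m z = 0] gives an [x] with [A *m x] constant, and this constant is 0
    because the columns of [A] also sum to 0. *)
Lemma simple_eigenvalue0_block (R : realType) (m : nat) (A : 'M[R]_(1 + m)) :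
  A^T = A -> A *m const_mx 1 = 0 :> 'cV_(1 + m) ->
  simple_eigenvalue A 0 <->
  (forall x : 'cV[R]_(1 + m), A *m x = 0 -> exists c, x = const_mx c).
Proof.
move=> symA A1.
pose u : 'cV[R]_m := const_mx 1.
pose l11 := ulsubmx A; pose l12 := ursubmx A.
pose l21 := dlsubmx A; pose l22 := drsubmx A.
have defA : A = block_mx l11 l12 l21 l22 by rewrite [RHS]submxK.
have const1 (c : R) : const_mx c = col_mx c%:M (c *: u) :> 'cV_(1 + m).
  apply/matrixP => i j; rewrite !mxE.
  case: splitP => k _; rewrite !mxE ?mulr1 //.
  by rewrite !ord1 mulr1n.
have u1 : const_mx 1 = col_mx 1%:M u :> 'cV[R]_(1 + m).
  by rewrite const1 scale1r.
have [e1 e2] : l11 = - (l12 *m u) /\ l21 = - (l22 *m u).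
  move: A1; rewrite defA u1 mul_block_col -col_mx0 !mulmx1 => /eq_col_mx[+ +].
  by move=> /eqP; rewrite addr_eq0 => /eqP-> /eqP; rewrite addr_eq0 => /eqP->.
pose M := l22 - u *m l12.
pose P : 'M[R]_(1 + m) := block_mx 1%:M 0 u 1%:M.
pose B : 'M[R]_(1 + m) := block_mx 0 l12 0 M.
have uP : P \in unitmx by rewrite unitmxE det_lblock !det1 mulr1 unitr1.
have AP : A *m P = P *m B.
  rewrite defA !mulmx_block e1 e2 !(mulmx0, mul0mx, mulmx1, mul1mx).
  by rewrite !(addr0, add0r) !addNr subrKC.
have charB : char_poly B = 'X * char_poly M.
  rewrite /char_poly /char_poly_mx map_block_mx /= !map_mx0.
  rewrite (scalar_mx_block 1 m).
  by rewrite opp_block_mx add_block_mx !oppr0 !addr0 det_ublock det_scalar1.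
have charM_neq0 : char_poly M != 0 by rewrite monic_neq0 ?char_poly_monic.
have -> : simple_eigenvalue A 0 <-> M \in unitmx.
  rewrite /simple_eigenvalue (char_poly_conj uP AP) charB mupM ?polyX_eq0 //.
  rewrite -[X in mup 0 X](subr0 'X) -[X in mup 0 X]expr1 mup_XsubCX eqxx.
  rewrite -unitmx_char_poly -mup_eq0 // add1n.
  by split=> [[->] | /eqP->].
split=> [/unitmx_ker0P kerM x | kerA].
  rewrite -[x](@vsubmxK _ 1) defA mul_block_col e1 e2 -(@col_mx0 R 1 m).
  set x1 := usubmx _; set x2 := dsubmx _ => /eq_col_mx[r1 r2].
  have {}r1 : l12 *m (x2 - u *m x1) = 0.
    by rewrite mulmxBr mulmxA addrC -mulNmx.
  have {}r2 : l22 *m (x2 - u *m x1) = 0.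
    by rewrite mulmxBr mulmxA addrC -mulNmx.
  exists (x1 0 0); rewrite const1 -mx11_scalar; congr col_mx.
  have /eqP : x2 - u *m x1 = 0.
    by apply: kerM; rewrite mulmxBl -mulmxA r1 r2 mulmx0 subr0.
  by rewrite subr_eq0 => /eqP->; rewrite {1}[x1]mx11_scalar mul_mx_scalar.
apply/unitmx_ker0P => z /eqP; rewrite mulmxBl subr_eq0 => /eqP Mz.
pose x : 'cV[R]_(1 + m) := col_mx 0 z.
have Ax : A *m x = const_mx 1 *m (l12 *m z).
  by rewrite defA mul_block_col !mulmx0 !add0r u1 mul_col_mx mul1mx Mz mulmxA.
have Ax0 : A *m x = 0.
  suff l12z0 : l12 *m z = 0 by rewrite Ax l12z0 mulmx0.
  have /(congr1 (fun v : 'rV_(1 + m) => v *m x)) :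
      (const_mx 1 : 'cV[R]_(1 + m))^T *m A = 0.
    by rewrite -[A in LHS]trmxK symA -trmx_mul A1 trmx0.
  rewrite -mulmxA Ax mul0mx mulmxA => /matrixP/(_ 0 0).
  rewrite [X in X *m _]mx11_scalar mul_scalar_mx !mxE => /eqP.
  under eq_bigr do rewrite !mxE mulr1.
  rewrite sumr_const card_ord mulf_eq0 pnatr_eq0 /= => /eqP h.
  by apply/matrixP => i j; rewrite !ord1 [RHS]mxE -h mxE.
have [c] := kerA _ Ax0; rewrite const1 => /eq_col_mx[/matrixP/(_ 0 0)].
by rewrite !mxE mulr1n => <- ->; rewrite scale0r.
Qed.

Lemma simple_eigenvalue0P (R : realType) (n : nat) (A : 'M[R]_n) :
  (0 < n)%N -> A^T = A -> A *m const_mx 1 = 0 :> 'cV_n ->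
  simple_eigenvalue A 0 <->
  (forall x : 'cV[R]_n, A *m x = 0 -> exists c, x = const_mx c).
Proof. by case: n A => // m A _; exact: simple_eigenvalue0_block. Qed.

(** * Quadratic forms *)

Definition qform (R : comNzRingType) (n : nat) (A : 'M[R]_n) (x : 'cV[R]_n) : R :=
  (x^T *m A *m x) 0 0.

Lemma qformD (R : comNzRingType) (n : nat) (A : 'M[R]_n) (x y : 'cV[R]_n) :
  A^T = A ->
  qform A (x + y) = qform A x + (y^T *m (A *m x)) 0 0 *+ 2 + qform A y.
Proof.
move=> symA; have trD : (x + y)^T = x^T + y^T by rewrite linearD.
rewrite /qform trD mulmxDr !mulmxDl.
have -> : x^T *m A *m y = y^T *m A *m x.
  rewrite [LHS]mx11_scalar -tr_scalar_mx -mx11_scalar.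
  by rewrite !trmx_mul trmxK symA mulmxA.
have mxD (M N : 'M[R]_1) : (M + N) 0 0 = M 0 0 + N 0 0 by rewrite mxE.
by rewrite !mxD mulmxA mulr2n !addrA.
Qed.

Lemma qformZ (R : comNzRingType) (n : nat) (A : 'M[R]_n) (a : R) (x : 'cV[R]_n) :
  qform A (a *: x) = a ^+ 2 * qform A x.
Proof.
have trZ : (a *: x)^T = a *: x^T by rewrite linearZ.
by rewrite /qform trZ -scalemxAr -!scalemxAl scalerA mxE expr2.
Qed.

Lemma sqnorm_eq0 (R : realDomainType) (n : nat) (x : 'cV[R]_n) :
  (x^T *m x) 0 0 <= 0 -> x = 0.
Proof.
rewrite mxE => sx.
have : \sum_j x^T 0 j * x j 0 == 0.
  by rewrite eq_le sx sumr_ge0 // => i _; rewrite mxE -expr2 sqr_ge0.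
rewrite psumr_eq0 => [/allP h | i _]; last by rewrite mxE -expr2 sqr_ge0.
apply/colP => i; have := h i (mem_index_enum i).
by rewrite /= !mxE mulf_eq0 orbb => /eqP.
Qed.

(** If [y = A x] were nonzero, moving from [x] a little in the direction [- y]
    would make the form negative. *)
Lemma psd_qform0 (R : realType) (n : nat) (A : 'M[R]_n) (x : 'cV[R]_n) :
  psd A -> qform A x = 0 -> A *m x = 0.
Proof.
move=> [symA psdA] qx0; apply: sqnorm_eq0.
set y := A *m x; set s := (y^T *m y) 0 0; set q := qform A y.
have q_ge0 : 0 <= q by exact: psdA.
have q1_gt0 : 0 < q + 1 by lra.
(* The step [s / (q + 1)] has the order of the minimizer [s / q], but makes sense
   when [q = 0]. *)
have : 0 <= qform A (x + (- (s / (q + 1))) *: y) by exact: psdA.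
rewrite qformD // qformZ qx0 linearZ /= -scalemxAl mxE -/s -/q.
have -> : 0 + - (s / (q + 1)) * s *+ 2 + (- (s / (q + 1))) ^+ 2 * q =
    - ((s / (q + 1)) ^+ 2 * (q + 2)).
  by field; rewrite gt_eqF.
rewrite oppr_ge0 pmulr_lle0; last by lra.
by rewrite exprn_even_le0 //= mulf_eq0 invr_eq0 (gt_eqF q1_gt0) orbF => /eqP->.
Qed.

(** * Restriction of potentials to sets of nodes *)

(** Multiplication by [restr_mx R X] restricts a potential to [X]; multiplication
    by its transpose extends a vector on [X] by zero.  With these two maps,
    statements about submatrices become statements about [L] itself. *)
Definition restr_mx (R : nzRingType) (V : finType) (X : {set V}) :
    'M[R]_(#|X|, #|V|) :=
  rowsub (fun i => enum_rank (enum_val i)) 1%:M.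

Lemma restr_mxE (R : nzRingType) (V : finType) (X : {set V})
    (x : 'cV[R]_#|V|) (i : 'I_#|X|) :
  (restr_mx R X *m x) i 0 = x (enum_rank (enum_val i)) 0.
Proof. by rewrite /restr_mx -rowsubE mxE. Qed.

Lemma node_submxE (R : realType) (V : finType) (L : 'M[R]_#|V|)
    (X Y : {set V}) :
  node_submx L X Y = restr_mx R X *m L *m (restr_mx R Y)^T.
Proof.
rewrite /restr_mx -rowsubE trmx_mxsub trmx1 mulmx_colsub mulmx1.
by apply/matrixP => i j; rewrite !mxE.
Qed.

Lemma restr_eq0P (R : nzRingType) (V : finType) (X : {set V})
    (x : 'cV[R]_#|V|) :
  (forall v, v \in X -> x (enum_rank v) 0 = 0) <-> restr_mx R X *m x = 0.
Proof.
split=> [x0 | Xx v vX].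
  by apply/colP => i; rewrite restr_mxE x0 ?enum_valP // mxE.
move/colP/(_ (enum_rank_in vX v)): Xx.
by rewrite restr_mxE enum_rankK_in // mxE.
Qed.

Lemma extE (R : nzRingType) (V : finType) (X : {set V})
    (y : 'cV[R]_#|X|) (v : V) :
  ((restr_mx R X)^T *m y) (enum_rank v) 0 =
  if [pick i | enum_val i == v] is Some i then y i 0 else 0.
Proof.
rewrite mxE; case: pickP => [i /eqP def_v | no_i].
  rewrite (bigD1 i) //= big1 => [|j j_neqi].
    by rewrite !mxE def_v eqxx mul1r addr0.
  by rewrite !mxE (inj_eq enum_rank_inj) -def_v (inj_eq enum_val_inj)
     (negPf j_neqi) mul0r.
by rewrite big1 // => i _; rewrite !mxE (inj_eq enum_rank_inj) no_i mul0r.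
Qed.

Lemma ext_in (R : nzRingType) (V : finType) (X : {set V})
    (y : 'cV[R]_#|X|) (i : 'I_#|X|) :
  ((restr_mx R X)^T *m y) (enum_rank (enum_val i)) 0 = y i 0.
Proof.
rewrite extE; case: pickP => [j /eqP/enum_val_inj-> // | /(_ i)].
by rewrite eqxx.
Qed.

Lemma ext_out (R : nzRingType) (V : finType) (X : {set V})
    (y : 'cV[R]_#|X|) (v : V) :
  v \notin X -> ((restr_mx R X)^T *m y) (enum_rank v) 0 = 0.
Proof.
move=> vX; rewrite extE; case: pickP => // i /eqP def_v.
by rewrite -def_v enum_valP in vX.
Qed.

Lemma dot_supp (R : nzRingType) (V : finType) (X : {set V})
    (x y : 'cV[R]_#|V|) :
  (forall v, v \notin X -> x (enum_rank v) 0 = 0) ->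
  (forall v, v \in X -> y (enum_rank v) 0 = 0) -> (x^T *m y) 0 0 = 0.
Proof.
move=> x0 y0; rewrite mxE big1 // => i _; rewrite mxE -(enum_valK i).
by case: (boolP (enum_val i \in X)) => [/y0-> | /x0->]; rewrite ?mulr0 ?mul0r.
Qed.

(** * The effective conductance as an energy *)

(** The potential that is 1 on [A], 0 on [B], and satisfies Kirchhoff's law
    [(L h) v = 0] at every other node: on the complement [C] it solves
    [L_CC h_C = - L_CA 1], which has a unique solution when [L_CC] is a unit. *)
Definition harmonic_potential (R : realType) (V : finType) (L : 'M[R]_#|V|)
    (A B : {set V}) : 'cV[R]_#|V| :=
  let C := ~: (A :|: B) in
  (restr_mx R A)^T *m const_mx 1 -
  (restr_mx R C)^T *m
    (invmx (node_submx L C C) *m (node_submx L C A *m const_mx 1)).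

Lemma harmonic_potential_in (R : realType) (V : finType) (L : 'M[R]_#|V|)
    (A B : {set V}) (v : V) :
  v \in A -> harmonic_potential L A B (enum_rank v) 0 = 1.
Proof.
move=> vA; rewrite /harmonic_potential mxE [X in _ + X]mxE.
rewrite [X in _ - X]ext_out ?subr0.
  by rewrite -(enum_rankK_in vA vA) ext_in mxE.
by rewrite !inE vA.
Qed.

Lemma harmonic_potential_out (R : realType) (V : finType) (L : 'M[R]_#|V|)
    (A B : {set V}) (v : V) : [disjoint A & B] ->
  v \in B -> harmonic_potential L A B (enum_rank v) 0 = 0.
Proof.
move=> dAB vB; rewrite /harmonic_potential mxE [X in _ + X]mxE.
rewrite !ext_out ?subr0 //.
  by rewrite !inE vB orbT.
by rewrite (disjointFl dAB vB).
Qed.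

Lemma harmonic_potential_harmonic (R : realType) (V : finType) (L : 'M[R]_#|V|)
    (A B : {set V}) (v : V) : geff_defined L A B ->
  v \notin A :|: B -> (L *m harmonic_potential L A B) (enum_rank v) 0 = 0.
Proof.
rewrite /geff_defined -in_setC; set C := ~: _ => uC; move: v; apply/restr_eq0P.
rewrite /harmonic_potential -/C !mulmxBr !mulmxA -!node_submxE.
by rewrite mulmxV // mul1mx subrr.
Qed.

(** Taking the Schur complement eliminates the potentials on the complement of
    [A :|: B] by Kirchhoff's law.  As [L h] vanishes there and [h] vanishes on
    [B], only the nodes of [A] contribute to the energy of [h]. *)
Lemma qform_harmonic_potential (R : realType) (V : finType) (L : 'M[R]_#|V|)
    (A B : {set V}) :
  L^T = L -> geff_defined L A B ->
  qform L (harmonic_potential L A B) = geff L A B.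
Proof.
move=> symL uC; set C := ~: (A :|: B); set h := harmonic_potential L A B.
have Ch : restr_mx R C *m (L *m h) = 0.
  by apply/restr_eq0P => v; rewrite in_setC => /harmonic_potential_harmonic->.
have tr_node X Y : (node_submx L X Y)^T = node_submx L Y X.
  by rewrite !node_submxE !trmx_mul trmxK symL mulmxA.
pose u : 'cV[R]_#|A| := const_mx 1.
have -> : qform L h = (u^T *m (restr_mx R A *m (L *m h))) 0 0.
  rewrite /qform -mulmxA {1}/h /harmonic_potential -/C linearB /= mulmxBl.
  rewrite [X in _ - X](_ : _ = 0) ?subr0.
    by rewrite trmx_mul trmxK -!mulmxA.
  by rewrite trmx_mul trmxK -mulmxA Ch mulmx0.
have -> : restr_mx R A *m (L *m h) =
    (node_submx L A A - node_submx L A C *m invmx (node_submx L C C)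
       *m node_submx L C A) *m u.
  by rewrite /h /harmonic_potential -/C !mulmxBr !mulmxBl !mulmxA -!node_submxE.
rewrite /geff /schur_compl -/C -/u; congr ((_ : 'M_1) 0 0).
rewrite tr_col_mx trmx_const mul_col_mx mul_col_row opp_block_mx add_block_mx.
rewrite trmx0 mul_row_block mul_row_col !mul0mx !addr0 mulmx0 addr0.
by rewrite tr_node mulmxA.
Qed.

(** * The two implications *)

(** Induction on [C], completing the square: for [a] in [C], take the harmonic
    potential [h] with value 1 at [a] and 0 outside [C].  If [x] is supported on
    [C] then [x = t h + z] with [t = x_a] and [z] supported on [C :\ a], where
    [L h] vanishes; hence the cross term is 0 and the energy of [x] is
    [t ^+ 2 * geff L [set a] (~: C)] plus that of [z].  This is the recursion
    of Sylvester's criterion, the effective conductance being the ratio of two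
    nested principal minors.  The hypothesis [C != setT] leaves a node outside
    [C], so that the second terminal set is non-empty. *)
Lemma geff_pos_def_supp (R : realType) (V : finType) (L : 'M[R]_#|V|)
    (C : {set V}) (x : 'cV[R]_#|V|) :
  L^T = L ->
  (forall A B : {set V}, A != set0 -> B != set0 -> [disjoint A & B] ->
     geff_defined L A B /\ 0 < geff L A B) ->
  C != setT -> (forall v, v \notin C -> x (enum_rank v) 0 = 0) ->
  x != 0 -> 0 < qform L x.
Proof.
move=> symL geff_gt0; have [k leCk] := ubnP #|C|.
elim: k => // k IH in C x leCk *; move=> CnT x_out x_neq0.
have [C0 | [a aC]] := set_0Vmem C.
  case/eqP: x_neq0; apply/colP => i.
  by rewrite -(enum_valK i) x_out ?mxE // C0 inE.
have daC : [disjoint [set a] & ~: C] by rewrite disjoints1 inE aC.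
have a_neq0 : [set a] != set0 by rewrite -card_gt0 cards1.
have C'_neq0 : ~: C != set0 by rewrite -setCT (inj_eq (@setC_inj V)).
have [uC g_gt0] := geff_gt0 _ _ a_neq0 C'_neq0 daC.
set h := harmonic_potential L [set a] (~: C).
pose t := x (enum_rank a) 0; pose z := x - t *: h.
have zE v : z (enum_rank v) 0 = x (enum_rank v) 0 - t * h (enum_rank v) 0.
  by rewrite /z mxE [X in _ + X]mxE [X in _ - X]mxE.
have z_out v : v \notin C :\ a -> z (enum_rank v) 0 = 0.
  rewrite in_setD1 negb_and negbK; case: (eqVneq v a) => [-> _ | _ /= vC].
    by rewrite zE harmonic_potential_in ?set11 // mulr1 subrr.
  by rewrite zE harmonic_potential_out ?in_setC // mulr0 subr0 x_out.
have Lh0 : (z^T *m (L *m (t *: h))) 0 0 = 0.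
  apply: (dot_supp z_out) => v; rewrite in_setD1 => /andP[v_neqa vC].
  rewrite -scalemxAr mxE harmonic_potential_harmonic ?mulr0 //.
  by rewrite !inE (negPf v_neqa) vC.
rewrite -(subrK (t *: h) x) -/z addrC qformD // Lh0 mul0rn addr0 qformZ.
rewrite qform_harmonic_potential //.
have tg_ge0 : 0 <= t ^+ 2 * geff L [set a] (~: C).
  by rewrite mulr_ge0 ?sqr_ge0 // ltW.
have [z0 | z_neq0] := eqVneq z 0.
  rewrite z0 /qform mulmx0 [X in _ + X]mxE addr0 mulr_gt0 // exprn_even_gt0 //=.
  apply: contraNneq x_neq0 => t0.
  by rewrite -(subrK (t *: h) x) -/z z0 t0 scale0r addr0.
apply: ltr_wpDl => //; apply: (IH (C :\ a)) => //.
  by move: leCk; rewrite (cardsD1 a C) aC.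
by apply: contraNneq CnT => CaT; rewrite -subTset -CaT subD1set.
Qed.

(** Both claims hold because a potential of zero energy lies in the kernel, hence
    is constant: one that vanishes on [A] is 0, so that [L_CC] is nonsingular; and
    the harmonic potential, being 1 on [A] and 0 on [B], is not constant. *)
Lemma psd_geff_pos (R : realType) (V : finType) (L : 'M[R]_#|V|) :
  psd L -> (forall x : 'cV[R]_#|V|, L *m x = 0 -> exists c, x = const_mx c) ->
  (forall A B : {set V}, A != set0 -> B != set0 -> [disjoint A & B] ->
     geff_defined L A B /\ 0 < geff L A B).
Proof.
move=> psdL kerL A B /set0Pn[a aA] /set0Pn[b bB] dAB; have symL := psdL.1.
have kerL0 x v : qform L x = 0 -> x (enum_rank v) 0 = 0 -> x = 0.
  move=> /(psd_qform0 psdL)/kerL[c ->]; rewrite mxE => ->.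
  by apply/matrixP => i j; rewrite !mxE.
have gdef : geff_defined L A B.
  rewrite /geff_defined; set C := ~: (A :|: B); apply/unitmx_ker0P => z Lz0.
  have : (restr_mx R C)^T *m z = 0.
    apply: (kerL0 _ a); last by rewrite ext_out // !inE aA.
    rewrite /qform trmx_mul trmxK -!mulmxA.
    by move: Lz0; rewrite node_submxE -!mulmxA => ->; rewrite mulmx0 mxE.
  by move=> z0; apply/colP => i; rewrite -ext_in z0 !mxE.
split=> //; rewrite -qform_harmonic_potential // lt_def (psdL.2 _) andbT.
apply/eqP => q0; have := harmonic_potential_in L B aA.
rewrite (kerL0 _ b q0) ?harmonic_potential_out // mxE => /eqP.
by rewrite eq_sym oner_eq0.
Qed.

(** A constant can be subtracted from any potential without changing its energy.
    Grounding a node [v] in this way leaves a potential supported on the proper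
    subset [[set~ v]], where the form is positive definite. *)
Lemma geff_pos_psd (R : realType) (V : finType) (L : 'M[R]_#|V|) :
  (0 < #|V|)%N -> L^T = L -> L *m const_mx 1 = 0 :> 'cV_#|V| ->
  (forall A B : {set V}, A != set0 -> B != set0 -> [disjoint A & B] ->
     geff_defined L A B /\ 0 < geff L A B) ->
  psd L /\ (forall x : 'cV[R]_#|V|, L *m x = 0 -> exists c, x = const_mx c).
Proof.
move=> V_gt0 symL L1 geff_gt0.
have [v _] : exists v : V, v \in predT by apply/card_gt0P.
have qform_shift c z : qform L (const_mx c + z) = qform L z.
  have Lc : L *m (const_mx c : 'cV_#|V|) = 0.
    rewrite (_ : const_mx c = c *: const_mx 1) -?scalemxAr ?L1 ?scaler0 //.
    by apply/matrixP => i j; rewrite !mxE mulr1.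
  rewrite qformD // {1}/qform -mulmxA Lc !mulmx0.
  by rewrite [X in X + _ + _]mxE [X in _ + X *+ 2 + _]mxE mul0rn !add0r.
have decomp x : exists c z, x = const_mx c + z /\ (z != 0 -> 0 < qform L z).
  set c := x (enum_rank v) 0; exists c, (x - const_mx c).
  split; first by rewrite addrC subrK.
  apply: (geff_pos_def_supp (C := [set~ v])) => //.
    by apply/eqP => /setP/(_ v); rewrite !inE eqxx.
  by move=> w; rewrite !inE negbK => /eqP->; rewrite !mxE subrr.
split=> [|x Lx0].
  split=> // x; rewrite -/(qform L x).
  have [c [z [-> z_pos]]] := decomp x; rewrite qform_shift.
  have [-> | /z_pos/ltW //] := eqVneq z 0.
  by rewrite /qform mulmx0 mxE.
have [c [z [def_x z_pos]]] := decomp x; exists c.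
have [z0 | /z_pos] := eqVneq z 0; first by rewrite def_x z0 addr0.
by rewrite -(qform_shift c) -def_x /qform -mulmxA Lx0 mulmx0 mxE ltxx.
Qed.

(** * The Laplacian *)

Lemma laplacian_sym (R : realType) (V : finType) (G : signed_graph R V)
    (o : {set V} -> V * V) : (laplacian G o)^T = laplacian G o.
Proof. by rewrite /laplacian !trmx_mul trmxK tr_diag_mx mulmxA. Qed.

Lemma laplacian_const (R : realType) (V : finType) (G : signed_graph R V)
    (o : {set V} -> V * V) :
  is_orientation G o -> laplacian G o *m const_mx 1 = 0 :> 'cV_#|V|.
Proof.
move=> ho; rewrite /laplacian -mulmxA.
suff -> : (incidence_mx G o)^T *m const_mx 1 = 0 :> 'cV_#|edges G|.
  by rewrite mulmx0.
apply/colP => k; rewrite !mxE.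
have eG := enum_valP k; move: (card_edge eG) (ho _ eG); set e := enum_val k.
case oe: (o e) => [i j] /= card_e def_e.
have j_neqi : j != i.
  by apply/eqP => ji; rewrite def_e ji setUid cards1 in card_e.
rewrite (reindex_onto enum_rank enum_val) => [|v _]; last exact: enum_valK.
transitivity (\sum_v (if v == i then 1 else if v == j then -1 else 0) : R).
  apply: eq_big => v; rewrite ?enum_rankK ?eqxx //.
  by rewrite !mxE enum_rankK mulr1 /= -/e oe.
rewrite (bigD1 i) // (bigD1 j) //= !eqxx (negPf j_neqi) big1 ?addr0 ?subrr //.
by move=> v /andP[/negPf-> /negPf->].
Qed.

Theorem corollary2 (R : realType) (V : finType) (G : signed_graph R V)
    (o : {set V} -> V * V) (ho : is_orientation G o) (hG : connected_graph G) :
  (psd (laplacian G o) /\ simple_eigenvalue (laplacian G o) 0) <->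
  (forall A B : {set V}, A != set0 -> B != set0 -> [disjoint A & B] ->
     geff_defined (laplacian G o) A B /\ 0 < geff (laplacian G o) A B).
Proof.
have symL := laplacian_sym G o; have L1 := laplacian_const ho.
have [V_gt0 _] := hG; rewrite (simple_eigenvalue0P V_gt0 symL L1).
split=> [[] | ]; [exact: psd_geff_pos | exact: geff_pos_psd].
Qed.
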